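(* Let $S$ be a Damek--Ricci space. For every integer $k\ge1$ there exist a smooth curve $\gamma_k\colon(0,\infty)\to S$ and a constant $b_k\ne0$ such that $\lim_{a\to\infty}r(\gamma_k(a))=+\infty$ and $\lim_{a\to\infty}(\mathbb{X}_0^k r)(\gamma_k(a))=b_k$.
   Context: Damek--Ricci space. Let $\nu\ge1$ and $\mu\ge0$ be integers and let $z\mapsto J_z$ be a linear map from $\mathbb{R}^\nu$ to skew-symmetric $\mu\times\mu$ real matrices such that $J_z$ is orthogonal whenever $|z|=1$ (so $\mu$ is even; the degenerate case $\mu=0$, where the variable $x$ is absent, is allowed). Let $(e_\ell)$, $(u_k)$ be the standard bases of $\mathbb{R}^\mu$, $\mathbb{R}^\nu$. $S=\mathbb{R}^\mu\times\mathbb{R}^\nu\times\mathbb{R}^+$ is the group with law $(x,z,a)(x',z',a')=\big(x+\sqrt a\,x',\,z+az'+\tfrac12\sqrt a\sum_{k=1}^\nu(J_{u_k}x,x')u_k,\,aa'\big)$ and identity $e=(0,0,1)$. Set $n=\mu+\nu+1=\dim S$. Left-invariant vector fields: $\mathbb{X}_0=a\partial_a$, $\mathbb{X}_\ell=\sqrt a\big(\partial_{x_\ell}+\tfrac12\sum_{k=1}^\nu(J_{u_k}x,e_\ell)\partial_{z_k}\big)$ for $1\le\ell\le\mu$, $\mathbb{X}_{\mu+k}=a\,\partial_{z_k}$ for $1\le k\le\nu$. $S$ carries the left-invariant Riemannian metric for which $\mathbb{X}_0,\dots,\mathbb{X}_{n-1}$ are orthonormal; $d$ is the Riemannian distance and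 $r=r(x,z,a)=d((x,z,a),e)$. It is known that $\cosh r=-1+2\big(\tfrac{a^{1/2}+a^{-1/2}}2+\tfrac18a^{-1/2}|x|^2\big)^2+\tfrac12a^{-1}|z|^2$. *)

(* Defs.v *)
From HB Require Import structures.
From mathcomp Require Import all_boot all_order all_algebra.
From mathcomp Require Import all_classical all_reals all_analysis.
Import Order.TTheory GRing.Theory Num.Theory.
Import numFieldNormedType.Exports.

Set Implicit Arguments.
Unset Strict Implicit.
Unset Printing Implicit Defensive.

Local Open Scope classical_set_scope.
Local Open Scope ring_scope.

(* The Euclidean inner product.  The norm `|x| that the library puts on column
   vectors is the sup norm; only its topology is used below. *)
Definition dotp (R : realType) (m : nat) (x y : 'cV[R]_m) : R :=
  \sum_(i < m) x i 0 * y i 0.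

Definition ebase (R : realType) (m : nat) (i : 'I_m) : 'cV[R]_m := delta_mx i 0.
Arguments ebase {R m} i.

(* Triples (x, z, a).  The space S is the open subset 0 < a of this vector
   space, which is also the tangent space of S at each of its points. *)
Definition ambient (R : realType) (mu nu : nat) : normedModType R :=
  ('cV[R]_mu * 'cV[R]_nu * R^o)%type.

Section DamekRicci.
Variables (R : realType) (mu nu : nat).
Variable J : {linear 'cV[R]_nu -> 'M[R]_mu}.

Local Notation V := (ambient R mu nu).

Definition in_S (p : V) : Prop := 0 < p.2.

Definition Jbracket (x x' : 'cV[R]_mu) : 'cV[R]_nu :=
  \sum_(k < nu) dotp (J (ebase k) *m x) x' *: ebase k.

Definition S_mul (p q : V) : V :=
  (p.1.1 + Num.sqrt p.2 *: q.1.1,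
   p.1.2 + p.2 *: q.1.2 + (2^-1 * Num.sqrt p.2) *: Jbracket p.1.1 q.1.1,
   p.2 * q.2).

Definition S_one : V := (0, 0, 1).

(* None, Some (inl l) and Some (inr k) stand for the indices 0, l and mu + k. *)
Definition frame (i : option ('I_mu + 'I_nu)) (p : V) : V :=
  match i with
  | None => (0, 0, p.2)
  | Some (inl l) => (Num.sqrt p.2 *: ebase l,
                     (Num.sqrt p.2 / 2) *: Jbracket p.1.1 (ebase l), 0)
  | Some (inr k) => (0, p.2 *: ebase k, 0)
  end.

Definition coframe (i : option ('I_mu + 'I_nu)) (p v : V) : R :=
  match i with
  | None => v.2 / p.2
  | Some (inl l) => v.1.1 l 0 / Num.sqrt p.2
  | Some (inr k) => (v.1.2 k 0 - 2^-1 * Jbracket p.1.1 v.1.1 k 0) / p.2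
  end.

(* The Riemannian metric at p: by frame_decomposition and frame_orthonormal
   below, it is the bilinear form making the frame at p orthonormal. *)
Definition metric (p v w : V) : R := \sum_i coframe i p v * coframe i p w.

Definition C1_path (g : R -> V) : Prop :=
  [/\ forall t, t \in `[0, 1] -> in_S (g t),
      forall t, t \in `[0, 1] -> derivable g t 1 &
      {within `[0, 1], continuous (derive1 g)}].

Definition path_length (g : R -> V) : R :=
  \int[lebesgue_measure]_(t in `[0, 1])
    Num.sqrt (metric (g t) (derive1 g t) (derive1 g t)).

(* joined p q L: some piecewise C^1 path in S from p to q has length L.  Each
   C^1 piece is parametrized by [0, 1]. *)
Inductive joined : V -> V -> R -> Prop :=
| joined_C1 (g : R -> V) : C1_path g -> joined (g 0) (g 1) (path_length g)
| joined_cat (p q s : V) (L L' : R) :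
    joined p q L -> joined q s L' -> joined p s (L + L').

Definition rdist (p q : V) : R := inf [set L : R | joined p q L].

Definition dist_one (p : V) : R := rdist p S_one.

Definition vf_act (X : V -> V) (f : V -> R^o) : V -> R^o :=
  fun p => 'D_(X p) f p.

Definition X0 : V -> V := frame None.

Definition X0_iter (k : nat) (f : V -> R^o) : V -> R^o := iter k (vf_act X0) f.

(* X0^k f genuinely exists at p: needed because 'D_v f p is defined for all f,
   with an arbitrary value when the limit does not exist.  The integral curve
   of X0 through p is, as a set, the ray p + s X0(p), s > -1, and only the
   values of f on it near p matter. *)
Definition X0_iter_exists (k : nat) (f : V -> R^o) (p : V) : Prop :=
  forall j, (j < k)%N -> \forall s \near (0 : R),
    let q := p + s *: X0 p in derivable (X0_iter j f) q (X0 q).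

Definition smooth_curve (g : R -> V) : Prop :=
  forall (j : nat) (a : R), 0 < a -> derivable (derive1n j g) a 1.

Lemma dotp_ebase (m : nat) (x : 'cV[R]_m) (i : 'I_m) : dotp x (ebase i) = x i 0.
Proof.
rewrite /dotp (bigD1 i) //= !mxE !eqxx mulr1 big1 ?addr0 // => j ji.
by rewrite !mxE (negbTE ji) mulr0.
Qed.

Lemma JbracketE (x y : 'cV[R]_mu) (k : 'I_nu) :
  Jbracket x y k 0 = dotp (J (ebase k) *m x) y.
Proof.
rewrite /Jbracket summxE (bigD1 k) //= !mxE !eqxx mulr1 big1 ?addr0 // => j jk.
by rewrite !mxE eq_sym (negbTE jk) mulr0.
Qed.

Lemma Jbracket0r (x : 'cV[R]_mu) : Jbracket x 0 = 0.
Proof.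
rewrite /Jbracket big1 // => k _; rewrite /dotp big1 ?scale0r // => i _.
by rewrite [X in _ * X]mxE mulr0.
Qed.

Lemma Jbracket0l (x : 'cV[R]_mu) : Jbracket 0 x = 0.
Proof.
rewrite /Jbracket big1 // => k _; rewrite mulmx0 /dotp big1 ?scale0r // => i _.
by rewrite mxE mul0r.
Qed.

Lemma JbracketZr (c : R) (x y : 'cV[R]_mu) :
  Jbracket x (c *: y) = c *: Jbracket x y.
Proof.
rewrite /Jbracket scaler_sumr; apply: eq_bigr => k _; rewrite scalerA.
congr (_ *: _); rewrite /dotp mulr_sumr; apply: eq_bigr => i _.
by rewrite [X in _ * X]mxE mulrCA.
Qed.

Lemma coframe_frame (p : V) (i j : option ('I_mu + 'I_nu)) :
  in_S p -> coframe i p (frame j p) = (i == j)%:R.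
Proof.
rewrite /in_S => p0; have s0 : Num.sqrt p.2 != 0 by rewrite sqrtr_eq0 -ltNge.
have pn0 : p.2 != 0 by rewrite gt_eqF.
case: i => [[l|k]|]; case: j => [[l'|k']|] //=.
- by rewrite !mxE eqxx andbT mulrAC divff // mul1r.
- by rewrite mxE mul0r.
- by rewrite mxE mul0r.
- by rewrite JbracketZr !mxE [2^-1 * _]mulrCA -mulrA subrr mul0r.
- by rewrite Jbracket0r !mxE mulr0 subr0 eqxx andbT mulrAC divff // mul1r.
- by rewrite Jbracket0r !mxE mulr0 subr0 mul0r.
- by rewrite mul0r.
- by rewrite mul0r.
- by rewrite divff.
Qed.

Lemma frame_orthonormal (p : V) (i j : option ('I_mu + 'I_nu)) :
  in_S p -> metric p (frame i p) (frame j p) = (i == j)%:R.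
Proof.
move=> pS; rewrite /metric (bigD1 i) //= !coframe_frame // eqxx mul1r.
rewrite big1 ?addr0 // => m mi.
by rewrite !coframe_frame // (negbTE mi) mul0r.
Qed.

(* Left translation by p is an affine map, so this says that its differential at
   S_one maps frame i S_one to frame i p. *)
Lemma frame_left_invariant (p : V) (i : option ('I_mu + 'I_nu)) (t : R) :
  S_mul p (S_one + t *: frame i S_one) = p + t *: frame i p.
Proof.
have s2 (c : R) : 2^-1 * c * t = t * (c / 2) by rewrite mulrC [2^-1 * _]mulrC.
case: p => [[x z] a]; rewrite /S_mul /S_one.
case: i => [[l|k]|]; rewrite /frame /=;
  congr (_, _, _); rewrite /= ?sqrtr1 ?scale1r ?add0r ?addr0 ?scaler0 ?addr0
    ?mulr1 ?Jbracket0r ?scaler0 ?addr0 ?Jbracket0l ?scaler0 ?addr0 ?mulr1 //.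
all: rewrite ?JbracketZr ?scalerA ?s2 //.
all: rewrite ?[t * a]mulrC ?[t * Num.sqrt a]mulrC //.
by rewrite mulrDr mulr1 [t *: _]mulr1 mulrC.
Qed.

Lemma frame_decomposition (p v : V) :
  in_S p -> v = \sum_i coframe i p v *: frame i p.
Proof.
rewrite /in_S => p0; have s0 : Num.sqrt p.2 != 0 by rewrite sqrtr_eq0 -ltNge.
have pn0 : p.2 != 0 by rewrite gt_eqF.
rewrite (bigD1 None) //= (reindex_omap Some id) /=; last by case.
under eq_bigl do rewrite eqxx.
rewrite big_sumType /=.
have sum1 T (F : T -> V) (s : seq T) :
    \sum_(t <- s) F t = (\sum_(t <- s) (F t).1.1, \sum_(t <- s) (F t).1.2,
                         \sum_(t <- s) (F t).2).
  elim: s => [|t s IH]; first by rewrite !big_nil.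
  by rewrite !big_cons IH; case: (F t) => [[]].
rewrite !sum1 /=.
have zero m n (F : 'I_m -> R) : \sum_(t < m) F t *: (0 : 'cV[R]_n) = 0.
  by rewrite big1 // => t _; rewrite scaler0.
have zeroR m (F : 'I_m -> R) : \sum_(t < m) F t *: (0 : R^o) = 0.
  by rewrite big1 // => t _; rewrite scaler0.
have coordE m (c : R) (F : 'I_m -> R) : c != 0 ->
    \sum_(t < m) (F t / c) *: (c *: ebase t) = \col_t F t.
  move=> c0; apply/colP => l; rewrite summxE mxE (bigD1 l) //= !mxE !eqxx.
  rewrite mulr1 divfK // big1 ?addr0 // => t tl.
  by rewrite !mxE eq_sym (negbTE tl) !mulr0.
rewrite zero !zeroR !coordE //.
have -> : \sum_(t < mu) (v.1.1 t 0 / Num.sqrt p.2) *: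
    ((Num.sqrt p.2 / 2) *: Jbracket p.1.1 (ebase t)) =
    2^-1 *: Jbracket p.1.1 v.1.1.
  apply/colP => l; rewrite summxE mxE JbracketE /dotp mulr_sumr.
  apply: eq_bigr => t _; rewrite [LHS]mxE [X in _ * X]mxE JbracketE dotp_ebase.
  by rewrite !mulrA divfK // [_ / 2]mulrC -!mulrA; congr (_ * _); rewrite mulrC.
case: v => [[x z] a]; congr (_, _, _) => /=.
- rewrite scaler0 add0r addr0; apply/colP => l; rewrite mxE //.
- rewrite scaler0 add0r; apply/colP => l; rewrite !mxE addrCA subrr addr0 //.
- by rewrite !addr0 [_ *: _]divfK.
Qed.

End DamekRicci.

(* Main.v *)
From HB Require Import structures.
Require Import Defs.
From mathcomp Require Import all_boot all_order all_algebra.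
From mathcomp Require Import all_classical all_reals all_analysis.
From mathcomp Require Import ring lra.
Import Order.TTheory GRing.Theory Num.Theory.
Import numFieldNormedType.Exports.
Local Open Scope classical_set_scope.
Local Open Scope ring_scope.

(** The field X_0 = a d/da keeps x and z fixed, so everything happens in the
half-plane of points (0, z e, a), where e is a basis vector of the centre.
Restricted to it the metric is (dz^2 + da^2) / a^2, and the half-plane is a
totally geodesic hyperbolic plane; on it cosh r = (1 + z^2 + a^2) / (2 a), that
is, with b = 1 + z^2 and T = sqrt ((b + a^2)^2 - 4 a^2),
  r = ln ((b + a^2 + T) / (2 a))     ([dist_one_slice]).
The distance formula is proved from the definition of r as an infimum of
lengths.
- Upper bound: the half-circle (c + rho tanh s, rho / cosh s) has unit speed
  ([joined_geodesic]).
- Lower bound: the map (x, z, a) |-> (<z, e>, a + |x|^2 / 4) onto the hyperbolic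
  plane is a contraction, because J_e is skew and orthogonal; composed with the
  Busemann function of an endpoint of the half-circle it gives a function whose
  gradient has norm at most 1 ([dbusemann_grad]) and which grows exactly at unit
  rate along the half-circle ([busemann_geodesic]).  Integrating along any path
  bounds the length from below ([lipschitz_joined]).

With w = a^2 / b and eps = 1 / b, one finds
  X_0 r = (w - 1) / sqrt Q,   Q = (w + 1)^2 - 4 eps w,
and X_0 acts on functions of w as 2 w d/dw.  Hence
  X_0^(j + 1) r = P_j(w, eps) / (sqrt Q)^(2 j + 1)
for explicit polynomials P_j ([numerator], [X0_iter_dist_one]).  At eps = 0 this
is the j-th derivative of tanh with respect to ln (sqrt w).  The linear
coefficient of P_j(w, 0) never vanishes ([numerator_coef]), so some w = c^2 is
not a root.  Along the curve z = sinh t, a = c cosh t the variable w keeps the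
value c^2 while eps = 1 / cosh^2 t tends to 0 and r tends to infinity; so
X_0^(j + 1) r tends to P_j(c^2, 0) / (c^2 + 1)^(2 j + 1), which is not 0. *)

(** * Derivatives, sums and inner products *)

Lemma is_derive_linear_comp {K : numFieldType} {U V W : normedModType K}
    (l : V -> W) (f : U -> V) (x v : U) (df : V) :
  linear l -> continuous l -> is_derive x v f df ->
  is_derive x v (l \o f) (l df).
Proof.
move=> lin cl [fd <-].
have lh : (fun h => h^-1 *: ((l \o f \o shift x) (h *: v) - (l \o f) x))
    @ 0^' --> l ('D_v f x).
  have -> : (fun h => h^-1 *: ((l \o f \o shift x) (h *: v) - (l \o f) x)) =
      l \o (fun h => h^-1 *: ((f \o shift x) (h *: v) - f x)).
    apply/funext => h /=.
    by rewrite (GRing.scalable_linear lin) (GRing.zmod_morphism_linear lin).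
  by apply: continuous_cvg; [exact: cl|exact: fd].
apply: DeriveDef; first by apply/cvg_ex; exists (l ('D_v f x)).
exact: cvg_lim lh.
Qed.

Lemma is_derive_scalel {R : realType} {V : normedModType R} (f : R -> R)
    (t df : R) (v : V) :
  is_derive t 1 f df -> is_derive t 1 (fun s => f s *: v) (df *: v).
Proof.
move=> fd; apply: (@is_derive_linear_comp R R^o R^o V ( *:%R ^~ v) f t 1 df).
  by move=> a b c; rewrite scalerDl scalerA.
exact: scalel_continuous.
Qed.

(** Differentiation preserves the shape of these curves, so the statement about
the j-th derivative and its derivability go together. *)
Lemma derive1n_exp_comb {R : realType} {V : normedModType R} (v w : V) j :
  derive1n j (fun a : R => expR a *: v + expR (- a) *: w) =
  (fun a : R => expR a *: v + expR (- a) *: ((-1) ^+ j *: w)) /\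
  forall a : R, derivable
    (fun a : R => expR a *: v + expR (- a) *: ((-1) ^+ j *: w)) a 1.
Proof.
have d (u : V) (a : R) : is_derive a 1
    (fun a : R => expR a *: v + expR (- a) *: u)
    (expR a *: v + expR (- a) *: (- u)).
  have nd : is_derive a 1 (fun a : R => expR (- a)) (- expR (- a)).
    have -> : - expR (- a) = expR (- a) * (- 1 : R) by ring.
    exact: (is_derive1_comp (is_derive_expR (- a)) (is_deriveNid a 1)).
  have := is_deriveD (is_derive_scalel _ a _ v (is_derive_expR a))
    (is_derive_scalel _ a _ u nd).
  by rewrite scaleNr scalerN.
split; last by move=> a; have [] := d ((-1) ^+ j *: w) a.
elim: j => [|j IH]; first by rewrite derive1n0 expr0 scale1r.
rewrite derive1nS IH; apply/funext => a; rewrite derive1E.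
by have [_ ->] := d ((-1) ^+ j *: w) a; rewrite exprS mulN1r scaleNr.
Qed.

Lemma big_option_sum {R : nmodType} {A B : finType} (F : option (A + B) -> R) :
  \sum_i F i = F None + (\sum_a F (Some (inl a)) + \sum_b F (Some (inr b))).
Proof.
rewrite (bigD1 None) //= (reindex_omap Some id) /=; last by case.
by under eq_bigl do rewrite eqxx; rewrite big_sumType.
Qed.

Section Dotp.
Context {R : realType} {m : nat}.
Implicit Types (x y : 'cV[R]_m) (M : 'M[R]_m).

Lemma dotpE x y : dotp x y = (x^T *m y) 0 0.
Proof. by rewrite !mxE; apply: eq_bigr => i _; rewrite !mxE. Qed.

Lemma dotp_skew M x : M^T = - M -> dotp x (M *m x) = 0.
Proof.
move=> MT; have : dotp x (M *m x) = - dotp x (M *m x).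
  rewrite dotpE; rewrite [LHS](_ : _ = (x^T *m (M *m x))^T 0 0).
    2: by rewrite [RHS]mxE.
  by rewrite !trmx_mul trmxK MT mulmxN mulNmx -mulmxA [LHS]mxE.
by lra.
Qed.

Lemma dotp_orth M x : M^T *m M = 1%:M -> dotp (M *m x) (M *m x) = dotp x x.
Proof.
by move=> MM; rewrite !dotpE trmx_mul -mulmxA (mulmxA M^T) MM mul1mx.
Qed.

Lemma dotp_ge0 x : 0 <= dotp x x.
Proof. by apply: sumr_ge0 => i _; rewrite -expr2 sqr_ge0. Qed.

Lemma dotp_lin_comb (a b : R) x y :
  \sum_i (a * x i 0 + b * y i 0) ^+ 2 =
  a ^+ 2 * dotp x x + 2 * a * b * dotp x y + b ^+ 2 * dotp y y.
Proof.
rewrite /dotp !mulr_sumr -!big_split /=; apply: eq_bigr => i _; ring.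
Qed.

End Dotp.

(** * Paths and their length *)

Section Coordinates.
Context {R : realType} {mu nu : nat}.
Local Notation V := (ambient R mu nu).

Lemma linear_coordx i : linear (fun p : V => p.1.1 i 0).
Proof. by move=> c p q; rewrite /= !mxE. Qed.

Lemma linear_coordz i : linear (fun p : V => p.1.2 i 0).
Proof. by move=> c p q; rewrite /= !mxE. Qed.

Lemma linear_coorda : linear (fun p : V => p.2).
Proof. by []. Qed.

Lemma continuous_coordx i : continuous (fun p : V => p.1.1 i 0).
Proof.
move=> p; apply: (@continuous_comp _ _ _ (fun p : V => p.1.1)
  (fun x : 'cV[R]_mu => x i 0)); last exact: coord_continuous.
by apply: (@continuous_comp _ _ _ fst fst); [exact: cvg_fst|exact: cvg_fst].
Qed.

Lemma continuous_coordz i : continuous (fun p : V => p.1.2 i 0).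
Proof.
move=> p; apply: (@continuous_comp _ _ _ (fun p : V => p.1.2)
  (fun x : 'cV[R]_nu => x i 0)); last exact: coord_continuous.
by apply: (@continuous_comp _ _ _ fst snd); [exact: cvg_fst|exact: cvg_snd].
Qed.

Lemma continuous_coorda : continuous (fun p : V => p.2 : R).
Proof. by move=> p; exact: cvg_snd. Qed.

End Coordinates.

Section Metric.
Context {R : realType} {mu nu : nat} (J : {linear 'cV[R]_nu -> 'M[R]_mu}).
Local Notation V := (ambient R mu nu).

Lemma coframe_cvg {T : Type} {F : set_system T} {FF : Filter F}
    (g v : T -> V) (p w : V) i :
  in_S p -> g @ F --> p -> v @ F --> w ->
  coframe J i (g t) (v t) @[t --> F] --> coframe J i p w.
Proof.
move=> p0 gp vw.
have ga : (g t).2 @[t --> F] --> p.2.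
  apply: (@cvg_comp _ _ _ g (fun q : V => q.2) _ _ _ gp).
  exact: continuous_coorda.
have va : (v t).2 @[t --> F] --> w.2.
  apply: (@cvg_comp _ _ _ v (fun q : V => q.2) _ _ _ vw).
  exact: continuous_coorda.
have gx l : (g t).1.1 l 0 @[t --> F] --> p.1.1 l 0.
  apply: (@cvg_comp _ _ _ g (fun q : V => q.1.1 l 0) _ _ _ gp).
  exact: continuous_coordx.
have vx l : (v t).1.1 l 0 @[t --> F] --> w.1.1 l 0.
  apply: (@cvg_comp _ _ _ v (fun q : V => q.1.1 l 0) _ _ _ vw).
  exact: continuous_coordx.
have vz l : (v t).1.2 l 0 @[t --> F] --> w.1.2 l 0.
  apply: (@cvg_comp _ _ _ v (fun q : V => q.1.2 l 0) _ _ _ vw).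
  exact: continuous_coordz.
case: i => [[l|k]|] /=.
- apply: cvgM => //; apply: cvgV.
    by rewrite sqrtr_eq0 -ltNge.
  by apply: continuous_cvg => //; exact: sqrt_continuous.
- apply: cvgM; last by apply: cvgV => //; rewrite gt_eqF.
  apply: cvgB => //; apply: cvgM; first exact: cvg_cst.
  under eq_fun do rewrite JbracketE; rewrite JbracketE.
  apply: (cvg_big add_continuous) => i _; apply: cvgM => //; rewrite mxE.
  under eq_fun do rewrite mxE.
  by apply: (cvg_big add_continuous) => j _; apply: cvgM => //; exact: cvg_cst.
- by apply: cvgM => //; apply: cvgV => //; rewrite gt_eqF.
Qed.

(** The integrability of the speed, and its being the derivative of the arc
length, both come from this continuity. *)
Lemma speed_continuous (g : R -> V) : C1_path g ->
  {within `[0, 1], continuous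
    (fun t => Num.sqrt (metric J (g t) (derive1 g t) (derive1 g t)))}.
Proof.
move=> [gS gd g'c]; apply/subspace_continuousP => t t01.
apply: continuous_cvg; first exact: sqrt_continuous.
have g't : derive1 g x @[x --> within `[0, 1] (nbhs t)] --> derive1 g t.
  by move/subspace_continuousP : g'c; exact.
have gt : g x @[x --> within `[0, 1] (nbhs t)] --> g t.
  apply: cvg_within_filter; apply: differentiable_continuous.
  by apply/derivable1_diffP/gd.
apply: (cvg_big add_continuous) => i _.
by apply: cvgM; apply: coframe_cvg => //; exact: gS.
Qed.

(** Cauchy-Schwarz in the orthonormal frame: expanding the sum of the squares
(v_i - l(v) l_i)^2 >= 0, with l(v) = \sum_i l_i v_i, gives
|v|^2 >= l(v)^2 (2 - |l|^2). *)
Lemma gradient_bound (l : V -> R^o) (p v : V) : linear l -> in_S p ->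
  \sum_i l (frame J i p) ^+ 2 <= 1 -> l v ^+ 2 <= metric J p v v.
Proof.
move=> lin pS grad1.
pose lM := GRing.isLinear.Build _ _ _ _ _ lin.
pose L : {linear V -> R^o} := HB.pack l lM.
have lv : l v = \sum_i coframe J i p v * l (frame J i p).
  rewrite {1}(@frame_decomposition _ _ _ J p v pS) -[l]/(L : V -> R^o).
  by rewrite linear_sum; apply: eq_bigr => i _; rewrite linearZ.
have : 0 <= \sum_i (coframe J i p v - l v * l (frame J i p)) ^+ 2.
  by apply: sumr_ge0 => i _; rewrite sqr_ge0.
have -> : \sum_i (coframe J i p v - l v * l (frame J i p)) ^+ 2 =
    metric J p v v - 2 * l v * l v +
    l v ^+ 2 * \sum_i l (frame J i p) ^+ 2.
  rewrite {3}lv !mulr_sumr -sumrB -big_split /=.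
  by apply: eq_bigr => i _; ring.
have : l v ^+ 2 * \sum_i l (frame J i p) ^+ 2 <= l v ^+ 2.
  by rewrite -[leRHS]mulr1 ler_wpM2l ?sqr_ge0.
rewrite -mulrA -expr2; lra.
Qed.

(** Both [f \o g] and the arc length are differentiable inside [0, 1], and the
derivative of their sum is nonnegative because the derivative of [f \o g] is at
most the speed in absolute value. *)
Lemma lipschitz_C1_path (f : V -> R) (df : V -> V -> R) (g : R -> V) :
  (forall (h : R -> V) t v, in_S (h t) ->
     is_derive t 1 h v -> is_derive t (1 : R) (f \o h) (df (h t) v)) ->
  (forall p v, in_S p -> df p v ^+ 2 <= metric J p v v) ->
  C1_path g -> f (g 0) - f (g 1) <= path_length J g.
Proof.
move=> fd f1 gC; have speedc := @speed_continuous g gC.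
case: gC => gS gd g'c.
pose speed t := Num.sqrt (metric J (g t) (derive1 g t) (derive1 g t)).
pose ell := parameterized_integral lebesgue_measure 0 ^~ speed.
have intspeed : lebesgue_measure.-integrable `[0, 1] (EFin \o speed).
  by apply: continuous_compact_integrable => //; exact: segment_compact.
have fgd (t : R) : t \in `[0, 1]%R ->
    is_derive t 1 (f \o g) (df (g t) (derive1 g t)).
  move=> t01; have gt : is_derive t 1 g (derive1 g t).
    by rewrite derive1E; apply/derivableP; exact: gd.
  exact: (fd g t _ (gS t t01) gt).
have elld (t : R) : t \in `]0, 1[%R -> is_derive t 1 ell (speed t).
  move=> /[dup] t01; rewrite in_itv /= => /andP[t0 t1].
  have [|//|dl <-] := @continuous_FTC1_closed R speed 0 t 1 t1 intspeed _ _.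
  - by [].
  - by apply: within_continuous_continuous t01.
  - by rewrite derive1E; exact/derivableP.
pose G t := f (g t) + ell t.
have Gd (t : R) : t \in `]0, 1[%R ->
    is_derive t 1 G (df (g t) (derive1 g t) + speed t).
  move=> t01; apply: is_deriveD; last exact: elld.
  by apply: fgd; exact: subset_itv_oo_cc.
have : G 0 <= G 1.
  apply: (@ger0_derive1_ndecr _ G 0 1) => //.
  - by move=> t /Gd [].
  - move=> t t01; rewrite derive1E; have [_ ->] := Gd t t01.
    have tS := gS t (subset_itv_oo_cc t01).
    have /ler_wsqrtr := f1 _ (derive1 g t) tS.
    rewrite sqrtr_sqr -/(speed t) ler_norml => /andP[? _]; lra.
  - move=> t; apply: continuousD.
      move: t; apply: derivable_within_continuous => t t01.
      by have [] := fgd t t01.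
    by move: t; exact: parameterized_integral_continuous.
rewrite /G /ell /parameterized_integral set_itv1 Rintegral_set1 /path_length.
by rewrite -/speed; lra.
Qed.

Lemma lipschitz_joined (f : V -> R) (df : V -> V -> R) (p q : V) (L : R) :
  (forall (h : R -> V) t v, in_S (h t) ->
     is_derive t 1 h v -> is_derive t (1 : R) (f \o h) (df (h t) v)) ->
  (forall p v, in_S p -> df p v ^+ 2 <= metric J p v v) ->
  joined J p q L -> f p - f q <= L.
Proof.
move=> fd f1; elim=> [g gC|{}p {}q s L1 L2 _ + _].
  exact: lipschitz_C1_path fd f1 gC.
by lra.
Qed.

End Metric.

(** * A function with gradient of norm at most 1 *)

Section Busemann.
Context {R : realType} {mu nu : nat} (J : {linear 'cV[R]_nu -> 'M[R]_mu}).
Context (k0 : 'I_nu) (xi : R).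
Local Notation V := (ambient R mu nu).
Local Notation M := (J (ebase k0)).

(** The height of the image of p under the contraction onto the upper
half-plane; the other coordinate of the image is the [k0]-th coordinate of z. *)
Definition height (p : V) : R := p.2 + dotp p.1.1 p.1.1 / 4.

Definition dheight (p v : V) : R := v.2 + dotp p.1.1 v.1.1 / 2.

(** The squared Euclidean distance in the half-plane from the image of p to the
boundary point xi. *)
Definition sqdist_end (p : V) : R :=
  (p.1.2 k0 0 - xi) ^+ 2 + height p ^+ 2.

(** The Busemann function ln (h / ((z - xi)^2 + h^2)) of the boundary point xi,
pulled back by the contraction onto the half-plane. *)
Definition busemann (p : V) : R := ln (height p) - ln (sqdist_end p).

Definition dbusemann (p v : V) : R :=
  ((height p)^-1 - 2 * height p / sqdist_end p) * dheight p v
  - 2 * (p.1.2 k0 0 - xi) / sqdist_end p * v.1.2 k0 0.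

Lemma height_gt0 p : in_S p -> 0 < height p.
Proof. by move=> p0; rewrite ltr_wpDr // divr_ge0 // dotp_ge0. Qed.

Lemma sqdist_end_gt0 p : in_S p -> 0 < sqdist_end p.
Proof.
by move=> p0; rewrite ltr_wpDl ?sqr_ge0 // exprn_gt0 // height_gt0.
Qed.

Lemma dbusemann_linear p : linear (dbusemann p : V -> R^o).
Proof.
move=> c v w; rewrite /dbusemann /dheight.
have -> : dotp p.1.1 (c *: v + w).1.1 =
    c * dotp p.1.1 v.1.1 + dotp p.1.1 w.1.1.
  rewrite /dotp mulr_sumr -big_split; apply: eq_bigr => i _ /=.
  by rewrite !mxE; ring.
rewrite /= !mxE /GRing.scale /=; ring.
Qed.

(** Write the differential at the image point as eta dh + zeta dz.  On the
frame it has the components a eta, (sqrt a / 2) (eta x + zeta J x) and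
a zeta.  Since J x is orthogonal to x and has the same norm, their squares
add up to a h (eta^2 + zeta^2), where h = a + |x|^2 / 4.  The Busemann
function of the half-plane has eta^2 + zeta^2 = 1 / h^2, so the total is
a / h <= 1. *)
Lemma dbusemann_grad p : M^T = - M -> M^T *m M = 1%:M -> in_S p ->
  \sum_i dbusemann p (frame J i p) ^+ 2 <= 1.
Proof.
move=> MT MM p0; have h0 := height_gt0 p p0; have N0 := sqdist_end_gt0 p p0.
have a0 : 0 < p.2 by [].
rewrite big_option_sum.
set eta := (height p)^-1 - 2 * height p / sqdist_end p.
set zeta := - (2 * (p.1.2 k0 0 - xi) / sqdist_end p).
have dotp0 : dotp p.1.1 0 = 0.
  by rewrite /dotp big1 // => i _; rewrite [X in _ * X]mxE mulr0.
have -> : dbusemann p (frame J None p) = eta * p.2.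
  by rewrite /dbusemann /dheight /= dotp0 mxE -/eta; ring.
have -> : \sum_l dbusemann p (frame J (Some (inl l)) p) ^+ 2 =
    p.2 / 4 * \sum_l (eta * p.1.1 l 0 + zeta * (M *m p.1.1) l 0) ^+ 2.
  rewrite mulr_sumr; apply: eq_bigr => l _.
  rewrite /dbusemann /dheight /= -/eta.
  have -> : dotp p.1.1 (Num.sqrt p.2 *: ebase l) = Num.sqrt p.2 * p.1.1 l 0.
    rewrite -(dotp_ebase p.1.1 l) /dotp mulr_sumr.
    by apply: eq_bigr => i _; rewrite [X in _ * X]mxE mulrCA.
  rewrite [(_ *: Jbracket _ _ _) k0 0]mxE JbracketE dotp_ebase.
  rewrite -[X in _ = X / 4 * _](sqr_sqrtr (ltW a0)) /zeta; field.
  by rewrite gt_eqF.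
have -> : \sum_k dbusemann p (frame J (Some (inr k)) p) ^+ 2 =
    (zeta * p.2) ^+ 2.
  rewrite (bigD1 k0) //= big1 ?addr0 => [|k kk0].
    rewrite /dbusemann /dheight /= dotp0 !mxE !eqxx /zeta /=.
    by congr (_ ^+ 2); ring.
  rewrite /dbusemann /dheight /= dotp0 !mxE eq_sym (negbTE kk0) /=.
  by ring.
rewrite dotp_lin_comb (dotp_skew M) // dotp_orth //.
have -> : (eta * p.2) ^+ 2 + (p.2 / 4 * (eta ^+ 2 * dotp p.1.1 p.1.1 +
    2 * eta * zeta * 0 + zeta ^+ 2 * dotp p.1.1 p.1.1) + (zeta * p.2) ^+ 2) =
    p.2 * height p * (eta ^+ 2 + zeta ^+ 2) by rewrite /height; field.
have -> : eta ^+ 2 + zeta ^+ 2 = (height p) ^- 2.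
  rewrite /eta /zeta; move: N0; rewrite /sqdist_end => N0.
  by field; rewrite !gt_eqF.
rewrite ler_pdivrMr ?exprn_gt0 // mul1r expr2.
by rewrite ler_pM2r // /height lerDl divr_ge0 // dotp_ge0.
Qed.

Lemma is_derive_busemann (h : R -> V) (t : R) (v : V) : in_S (h t) ->
  is_derive t 1 h v -> is_derive t (1 : R) (busemann \o h) (dbusemann (h t) v).
Proof.
move=> hS hd; have h0 := height_gt0 _ hS; have N0 := sqdist_end_gt0 _ hS.
have da : is_derive t 1 (fun s => (h s).2 : R) v.2.
  exact: (is_derive_linear_comp (fun p : V => p.2) h t 1 v linear_coorda
    continuous_coorda hd).
have dz : is_derive t 1 (fun s => (h s).1.2 k0 0) (v.1.2 k0 0).
  exact: (is_derive_linear_comp (fun p : V => p.1.2 k0 0 : R^o) h t 1 v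
    (linear_coordz k0) (continuous_coordz k0) hd).
have dx i : is_derive t 1 (fun s => (h s).1.1 i 0) (v.1.1 i 0).
  exact: (is_derive_linear_comp (fun p : V => p.1.1 i 0 : R^o) h t 1 v
    (linear_coordx i) (continuous_coordx i) hd).
have ddot : is_derive t 1 (fun s => dotp (h s).1.1 (h s).1.1)
    (2 * dotp (h t).1.1 v.1.1).
  have -> : (fun s => dotp (h s).1.1 (h s).1.1) =
      \sum_(i < mu) (fun s => (h s).1.1 i 0 * (h s).1.1 i 0).
    by apply/funext => s; rewrite fct_sumE.
  rewrite /dotp mulr_sumr; apply: is_derive_sum => i.
  apply: is_derive_eq; rewrite /GRing.scale /=; ring.
have dh : is_derive t 1 (height \o h) (dheight (h t) v).
  rewrite /comp /height; apply: is_derive_eq => //.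
  by rewrite /dheight /GRing.scale /=; field.
have dN : is_derive t 1 (sqdist_end \o h)
    (2 * ((h t).1.2 k0 0 - xi) * v.1.2 k0 0 +
     2 * height (h t) * dheight (h t) v).
  have -> : sqdist_end \o h = (fun s => ((h s).1.2 k0 0 - xi)) ^+ 2 +
      (height \o h) ^+ 2.
    by apply/funext => s.
  by apply: is_derive_eq => //; rewrite /dheight /GRing.scale /=; field.
have lh : is_derive t 1 (@ln R \o (height \o h))
    ((height (h t))^-1 * dheight (h t) v).
  exact: (@is_derive1_comp R (@ln R) (height \o h) t _ _ (is_derive1_ln h0) dh).
have lN : is_derive t 1 (@ln R \o (sqdist_end \o h))
    ((sqdist_end (h t))^-1 * (2 * ((h t).1.2 k0 0 - xi) * v.1.2 k0 0 +
     2 * height (h t) * dheight (h t) v)).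
  exact: (@is_derive1_comp R (@ln R) (sqdist_end \o h) t _ _
    (is_derive1_ln N0) dN).
have -> : busemann \o h =
  (@ln R \o (height \o h)) - (@ln R \o (sqdist_end \o h)) by [].
apply: is_derive_eq (is_deriveB lh lN) _.
by rewrite /dbusemann; field; rewrite !gt_eqF.
Qed.

Lemma busemann_joined p q L : M^T = - M -> M^T *m M = 1%:M ->
  joined J p q L -> busemann p - busemann q <= L.
Proof.
move=> MT MM; apply: (lipschitz_joined J busemann dbusemann).
  exact: is_derive_busemann.
move=> {}p v pS; apply: gradient_bound => //; first exact: dbusemann_linear.
exact: dbusemann_grad.
Qed.

End Busemann.

(** * The hyperbolic half-plane x = 0 and the distance in it *)

Section Hyperbolic.
Context {R : realType}.

(** With E = e^s this is 1 / (E^2 + 1); tanh s and 1 / cosh s are written with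
it so that all derivatives below are polynomial in E and [fermi s]. *)
Definition fermi (s : R) : R := (expR s ^+ 2 + 1)^-1.

Definition tnh (s : R) : R := 1 - 2 * fermi s.

Definition sch (s : R) : R := 2 * expR s * fermi s.

Lemma fermi_gt0 s : 0 < fermi s.
Proof. by rewrite invr_gt0 ltr_wpDl ?sqr_ge0. Qed.

Lemma fermiV s : (expR s ^+ 2 + 1) * fermi s = 1.
Proof. by rewrite divff // gt_eqF // ltr_wpDl ?sqr_ge0. Qed.

Lemma sch_gt0 s : 0 < sch s.
Proof. by rewrite mulr_gt0 ?fermi_gt0 // mulr_gt0 ?expR_gt0. Qed.

Lemma tnh2_sch2 s : tnh s ^+ 2 + sch s ^+ 2 = 1.
Proof. rewrite /tnh /sch; have := fermiV s; nra. Qed.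

Global Instance is_derive_fermi (s : R) :
  is_derive s 1 fermi (- (2 * expR s ^+ 2 * fermi s ^+ 2)).
Proof.
have E0 : expR s ^+ 2 + 1 != 0 by rewrite gt_eqF // ltr_wpDl ?sqr_ge0.
have dE : is_derive s 1 (fun s : R => expR s ^+ 2 + 1) (2 * expR s ^+ 2).
  have -> : (fun s : R => expR s ^+ 2 + 1) = (@expR R) ^+ 2 + cst 1 by [].
  by apply: is_derive_eq; rewrite /GRing.scale /=; ring.
have dF : is_derive s 1 fermi _ := @is_deriveV R _ s _ 1 E0 dE.
apply: is_derive_eq dF _.
by rewrite /GRing.scale /= -exprVn /fermi; ring.
Qed.

Lemma is_derive_tnh (s : R) : is_derive s 1 tnh (sch s ^+ 2).
Proof.
have -> : tnh = cst 1 - 2 *: fermi by [].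
apply: is_derive_eq; rewrite /sch /GRing.scale /=; ring.
Qed.

Lemma is_derive_sch (s : R) : is_derive s 1 sch (- (sch s * tnh s)).
Proof.
suff : is_derive s 1 (cst 2 * @expR R * fermi : R -> R) (- (sch s * tnh s)).
  by [].
apply: is_derive_eq; rewrite /tnh /sch /= /GRing.scale /=.
have -> : (cst 2 * @expR R) s = 2 * expR s by [].
have ED : expR s ^+ 2 * fermi s = 1 - fermi s by have := fermiV s; lra.
transitivity (2 * expR s * fermi s - 4 * (expR s * fermi s) *
  (expR s ^+ 2 * fermi s)); first by ring.
rewrite ED; ring.
Qed.

End Hyperbolic.

Section Slice.
Context {R : realType} {mu nu : nat} (J : {linear 'cV[R]_nu -> 'M[R]_mu}).
Context (k0 : 'I_nu).
Local Notation V := (ambient R mu nu).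

Definition slice (z a : R) : V := (0, z *: ebase k0, a).

Lemma sliceE z a :
  slice z a = z *: (0, ebase k0, 0 : R^o) + a *: (0, 0, 1 : R^o).
Proof.
rewrite /slice; congr (_, _, _); rewrite /= ?scaler0 ?addr0 //.
by rewrite add0r /GRing.scale /= mulr1.
Qed.

Lemma is_derive_slice (f g : R -> R) (t df dg : R) :
  is_derive t 1 f df -> is_derive t 1 g dg ->
  is_derive t 1 (fun s => slice (f s) (g s)) (slice df dg).
Proof.
move=> fd gd; rewrite sliceE; under eq_fun do rewrite sliceE.
exact: (is_deriveD
  (is_derive_scalel f t df ((0, ebase k0, 0 : R^o) : V) fd)
  (is_derive_scalel g t dg ((0, 0, 1 : R^o) : V) gd)).
Qed.

Lemma metric_slice z a w b : 0 < a ->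
  metric J (slice z a) (slice w b) (slice w b) = (w ^+ 2 + b ^+ 2) / a ^+ 2.
Proof.
move=> a0; rewrite /metric big_option_sum /= [X in _ + (X + _)]big1 => [|l _].
  rewrite (bigD1 k0) //= big1 => [|k kk0].
    rewrite Jbracket0l !mxE eqxx /=; field.
    by rewrite gt_eqF.
  by rewrite Jbracket0l !mxE (negbTE kk0) /= !(mulr0, subr0, mul0r).
by rewrite mxE !mul0r.
Qed.

(** The half-circle of centre c and radius rho, which is orthogonal to the
boundary of the half-plane. *)
Definition geodesic (c rho s : R) : V := slice (c + rho * tnh s) (rho * sch s).

Lemma joined_geodesic c rho s s' : 0 < rho ->
  joined J (geodesic c rho s) (geodesic c rho s') `|s' - s|.
Proof.
move=> rho0; pose sg (t : R) := s + t * (s' - s).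
pose g t := geodesic c rho (sg t).
have sgd (t : R) : is_derive t 1 sg (s' - s).
  have -> : sg = cst s + (s' - s) *: (@id R).
    by apply/funext => u; rewrite /sg mulrC.
  by apply: is_derive_eq; rewrite /GRing.scale /= add0r mulr1.
have tnhd (t : R) : is_derive t 1 (tnh \o sg) (sch (sg t) ^+ 2 * (s' - s)).
  exact: (@is_derive1_comp R tnh sg t _ _ (is_derive_tnh _) (sgd t)).
have schd (t : R) : is_derive t 1 (sch \o sg)
    (- (sch (sg t) * tnh (sg t)) * (s' - s)).
  exact: (@is_derive1_comp R sch sg t _ _ (is_derive_sch _) (sgd t)).
pose zd t := rho * (sch (sg t) ^+ 2 * (s' - s)).
pose ad t := rho * (- (sch (sg t) * tnh (sg t)) * (s' - s)).
have gd (t : R) : is_derive t 1 g (slice (zd t) (ad t)).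
  apply: (is_derive_slice (cst c + rho *: (tnh \o sg)) (rho *: (sch \o sg))).
  by apply: is_derive_eq; rewrite add0r.
have gdE : derive1 g = fun t => slice (zd t) (ad t).
  by apply/funext => t; rewrite derive1E; have [_ ->] := gd t.
have dslice (t : R) : derivable (fun t => slice (zd t) (ad t)) t 1.
  have zdd : derivable (rho *: ((sch \o sg) ^+ 2 * cst (s' - s)) : R -> R) t 1.
    exact: ex_derive.
  have add : derivable
      (rho *: (- ((sch \o sg) * (tnh \o sg)) * cst (s' - s)) : R -> R) t 1.
    exact: ex_derive.
  by have [] := is_derive_slice _ _ _ _ _ (derivableP zdd) (derivableP add).
have gS (t : R) : in_S (g t).
  by rewrite /in_S /= mulr_gt0 // sch_gt0.
have gC : C1_path g.
  split=> [t _|t _|]; [exact: gS|by have [] := gd t|].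
  rewrite gdE; apply: continuous_subspaceT => t.
  exact/differentiable_continuous/derivable1_diffP.
have := joined_C1 J gC.
rewrite /g /sg mul0r addr0 mul1r addrC subrK.
congr (joined _ _ _ _); rewrite /path_length.
under eq_Rintegral => t _.
  rewrite gdE /g /geodesic metric_slice; last by rewrite mulr_gt0 // sch_gt0.
  have -> : (zd t ^+ 2 + ad t ^+ 2) / (rho * sch (sg t)) ^+ 2 = (s' - s) ^+ 2.
    rewrite -[RHS]mulr1 -(tnh2_sch2 (sg t)) /zd /ad; field.
    by rewrite !gt_eqF // sch_gt0.
  rewrite sqrtr_sqr; over.
rewrite Rintegral_cst //= lebesgue_measure_itv /= lte_fin ltr01 oppr0 adde0.
by rewrite mulr1.
Qed.

(** The end c + rho is the limit of the half-circle as s tends to infinity, so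
the Busemann function increases at unit rate along it. *)
Lemma busemann_geodesic c rho s : 0 < rho ->
  busemann k0 (c + rho) (geodesic c rho s) = s - ln (2 * rho).
Proof.
move=> rho0; set p := geodesic c rho s.
have hE : height p = rho * sch s.
  by rewrite /height /= /dotp big1 ?mul0r ?addr0 // => i _; rewrite mxE mul0r.
have F0 := fermi_gt0 s; have E0 := expR_gt0 s.
have NE : sqdist_end k0 (c + rho) p = 4 * rho ^+ 2 * fermi s.
  rewrite /sqdist_end hE /= !mxE !eqxx /= /tnh /sch.
  transitivity (4 * rho ^+ 2 * fermi s * ((expR s ^+ 2 + 1) * fermi s)).
    by ring.
  by rewrite fermiV mulr1.
rewrite /busemann hE NE -ln_div ?posrE ?mulr_gt0 ?sch_gt0 ?exprn_gt0 //.
have -> : rho * sch s / (4 * rho ^+ 2 * fermi s) = expR s / (2 * rho).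
  by rewrite /sch; field; rewrite !gt_eqF.
by rewrite ln_div ?posrE ?mulr_gt0 // expRK.
Qed.

Lemma rdist_geodesic c rho s s' :
  (J (ebase k0))^T = - J (ebase k0) ->
  (J (ebase k0))^T *m J (ebase k0) = 1%:M ->
  0 < rho -> s' <= s ->
  rdist J (geodesic c rho s) (geodesic c rho s') = s - s'.
Proof.
move=> MT MM rho0 ss'; have jg := joined_geodesic c rho s s' rho0.
have lbd : lbound [set L | joined J (geodesic c rho s) (geodesic c rho s') L]
    (s - s').
  move=> L /(busemann_joined J k0 (c + rho) _ _ _ MT MM).
  by rewrite !busemann_geodesic //; lra.
apply/eqP; rewrite eq_le; apply/andP; split.
  have -> : s - s' = `|s' - s| by rewrite ler0_norm; lra.
  by apply: ge_inf => //; exists (s - s').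
by apply: lb_le_inf => //; exists `|s' - s|.
Qed.

(** The arc-length parameter of a point (z, a) of the circle is determined by
e^s = (rho + z - c) / a. *)
Lemma geodesic_through c rho z a : 0 < rho -> 0 < a ->
  (z - c) ^+ 2 + a ^+ 2 = rho ^+ 2 ->
  0 < rho + z - c /\
  slice z a = geodesic c rho (ln ((rho + z - c) / a)).
Proof.
move=> rho0 a0 circ.
have pos : 0 < rho + z - c.
  by have : 0 < (rho + z - c) * (rho - (z - c)); nra.
split=> //; set s := ln _.
have Es : expR s = (rho + z - c) / a by rewrite lnK // posrE divr_gt0.
have FE : fermi s = a ^+ 2 / (2 * rho * (rho + z - c)).
  rewrite /fermi Es.
  have -> : ((rho + z - c) / a) ^+ 2 + 1 = 2 * rho * (rho + z - c) / a ^+ 2.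
    have -> : 2 * rho * (rho + z - c) = (rho + z - c) ^+ 2 + a ^+ 2.
      have -> : a ^+ 2 = rho ^+ 2 - (z - c) ^+ 2 by rewrite -circ; ring.
      ring.
    by field; rewrite gt_eqF.
  by rewrite invf_div.
rewrite /geodesic /tnh /sch Es FE; congr slice.
  have -> : a ^+ 2 = rho ^+ 2 - (z - c) ^+ 2 by rewrite -circ; ring.
  by field; rewrite !gt_eqF.
by field; rewrite !gt_eqF.
Qed.

(** The half-circle through (0, 1) and (z, a) has centre
c = (z^2 + a^2 - 1) / (2 z), which is why z must not vanish.  The difference of
the two parameters is ln of ((rho + z - c) / a) (rho - c)^-1, and
(rho - c)^-1 = rho + c since rho^2 = c^2 + 1. *)
Lemma dist_one_slice z a :
  (J (ebase k0))^T = - J (ebase k0) ->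
  (J (ebase k0))^T *m J (ebase k0) = 1%:M ->
  0 < z -> 0 < a ->
  dist_one J (slice z a) =
  ln ((1 + z ^+ 2 + a ^+ 2 +
       Num.sqrt ((1 + z ^+ 2 + a ^+ 2) ^+ 2 - 4 * a ^+ 2)) / (2 * a)).
Proof.
move=> MT MM z0 a0.
pose c := (z ^+ 2 + a ^+ 2 - 1) / (2 * z).
pose rho := Num.sqrt (c ^+ 2 + 1).
have c1 : 0 < c ^+ 2 + 1 by rewrite ltr_wpDl ?sqr_ge0.
have rho0 : 0 < rho by rewrite sqrtr_gt0.
have rho2 : rho ^+ 2 = c ^+ 2 + 1 by rewrite sqr_sqrtr // ltW.
have cE : 2 * z * c = z ^+ 2 + a ^+ 2 - 1.
  by rewrite /c; field; rewrite gt_eqF.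
have [pos1 oneE] : 0 < rho + 0 - c /\
    slice 0 1 = geodesic c rho (ln ((rho + 0 - c) / 1)).
  by apply: geodesic_through => //; rewrite rho2; ring.
have [pos2 pE] : 0 < rho + z - c /\
    slice z a = geodesic c rho (ln ((rho + z - c) / a)).
  apply: geodesic_through => //; rewrite rho2.
  have -> : (z - c) ^+ 2 = z ^+ 2 - 2 * z * c + c ^+ 2 by ring.
  by rewrite cE; ring.
have -> : Num.sqrt ((1 + z ^+ 2 + a ^+ 2) ^+ 2 - 4 * a ^+ 2) = 2 * z * rho.
  have -> : (1 + z ^+ 2 + a ^+ 2) ^+ 2 - 4 * a ^+ 2 = (2 * z * rho) ^+ 2.
    have -> : (2 * z * rho) ^+ 2 = (2 * z * c) ^+ 2 + 4 * z ^+ 2.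
      by rewrite exprMn rho2; ring.
    by rewrite cE; ring.
  by rewrite sqrtr_sqr ger0_norm // !mulr_ge0 // ltW.
(* (rho - c) (rho + c) = rho ^ 2 - c ^ 2 = 1 *)
have inv1 : ((rho + 0 - c) / 1)^-1 = rho + c.
  rewrite divr1; apply: (mulfI (lt0r_neq0 pos1)).
  by rewrite divff ?lt0r_neq0 // addr0 -subr_sqr rho2 addrAC subrr add0r.
have quotE : (1 + z ^+ 2 + a ^+ 2 + 2 * z * rho) / (2 * a) =
    ((rho + z - c) / a) / ((rho + 0 - c) / 1).
  rewrite inv1.
  have -> : 1 + z ^+ 2 + a ^+ 2 + 2 * z * rho =
      2 * ((rho ^+ 2 - c ^+ 2) + z * (rho + c)).
    have -> : a ^+ 2 = 2 * z * c + 1 - z ^+ 2 by rewrite cE; ring.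
    by rewrite rho2; ring.
  by field; rewrite gt_eqF.
have q1 : 0 < (rho + 0 - c) / 1 by rewrite divr1.
have q2 : 0 < (rho + z - c) / a by rewrite divr_gt0.
have S_oneE : S_one R mu nu = slice 0 1 by rewrite /slice scale0r.
rewrite /dist_one S_oneE oneE pE rdist_geodesic // ?quotE.
  by rewrite [RHS]ln_div ?posrE.
(* The order of the parameters amounts to 2 a <= 1 + a ^ 2. *)
rewrite ler_ln ?posrE // -[leLHS]mul1r -ler_pdivlMr // -quotE.
rewrite ler_pdivlMr ?mulr_gt0 //.
have : 0 <= z * rho by rewrite mulr_ge0 // ltW.
by have := sqr_ge0 (a - 1); have := sqr_ge0 z; nra.
Qed.

End Slice.

(** * Iterating 2 w d/dw on P / (sqrt Q)^m *)

Local Notation specialize e := (map_poly (horner_eval e)).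

Section Numerators.
Context {R : realType}.

(** The polynomial Q = w^2 + (2 - 4 eps) w + 1.  The outer indeterminate is w,
the inner one is eps: as a polynomial in w it can be differentiated, and as a
polynomial in eps its values are continuous. *)
Definition radicand : {poly {poly R}} :=
  'X^2 + (2%:P - 4%:P * 'X)%:P * 'X + 1.

(** The numerators P_j: applying 2 w d/dw to P / (sqrt Q)^m gives
w (2 P' Q - m P Q') / (sqrt Q)^(m + 2), here with m = 2 j + 1. *)
Fixpoint numerator (j : nat) : {poly {poly R}} :=
  if j is i.+1 then
    'X * ((numerator i)^`() * radicand *+ 2
          - numerator i * radicand^`() *+ (2 * i + 1))
  else 'X - 1.

Lemma specialize_horner (e : R) p w : (specialize e p).[w] = p.[w%:P].[e].
Proof.
transitivity (specialize e p).[horner_eval e w%:P]; last first.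
  exact: horner_map.
by congr horner; rewrite /horner_eval hornerC.
Qed.

Lemma specialize_radicand (e : R) w :
  (specialize e radicand).[w] = w ^+ 2 + (2 - 4 * e) * w + 1.
Proof. by rewrite specialize_horner !hornerE. Qed.

Lemma radicand_gt0 (e : R) w :
  e < 1 -> 0 < w -> 0 < (specialize e radicand).[w].
Proof.
move=> e1 w0; rewrite specialize_radicand.
have -> : w ^+ 2 + (2 - 4 * e) * w + 1 = (w - 1) ^+ 2 + 4 * (1 - e) * w by ring.
by rewrite ltr_wpDl ?sqr_ge0 // mulr_gt0 // mulr_gt0 // subr_gt0.
Qed.

Lemma specialize_numeratorS (e : R) i :
  let p := specialize e (numerator i) in
  let q := specialize e radicand in
  specialize e (numerator i.+1) =
    'X * (p^`() * q *+ 2 - p * q^`() *+ (2 * i + 1)).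
Proof.
rewrite /= rmorphM rmorphB !rmorphMn !rmorphM /= map_polyX.
by rewrite !deriv_map.
Qed.

Definition iterate (j : nat) (e w : R) : R :=
  (specialize e (numerator j)).[w] *
  (Num.sqrt (specialize e radicand).[w])^-1 ^+ (2 * j + 1).

Lemma is_derive_iterate j (e w : R) : e < 1 -> 0 < w ->
  is_derive w 1 (iterate j e) (iterate j.+1 e w / (2 * w)).
Proof.
move=> e1 w0; have q0 := radicand_gt0 e w e1 w0.
set q := specialize e radicand in q0 *.
pose S (w : R) := (Num.sqrt q.[w])^-1.
have s0 : Num.sqrt q.[w] != 0 by rewrite gt_eqF // sqrtr_gt0.
have qd : is_derive w 1 (@Num.sqrt R \o horner q)
    ((2 * Num.sqrt q.[w])^-1 * q^`().[w]).
  exact: (is_derive1_comp (is_derive1_sqrt q0) (is_derive_poly q w)).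
have Sd : is_derive w 1 S _ := @is_deriveV R _ w _ 1 s0 qd.
pose p := specialize e (numerator j).
have -> : iterate j e = horner p * S ^+ (2 * j + 1).
  by apply/funext => v; rewrite /iterate mulrfctE exprfctE.
have pd : is_derive w 1 (horner p) p^`().[w] := is_derive_poly p w.
apply: is_derive_eq; rewrite /iterate specialize_numeratorS -/p -/q.
rewrite !hornerE /= /GRing.scale /=.
have -> : (S ^+ (2 * j + 1)) w = S w ^+ (2 * j + 1) by rewrite exprfctE.
have q2 : q.[w] = Num.sqrt q.[w] ^+ 2 by rewrite sqr_sqrtr // ltW.
rewrite /S /= addn1 mulnS addn1 -[(2 + 2 * j)%N]/(2 * j).+2 !exprS /=.
rewrite hornerMn hornerM; move: (Num.sqrt q.[w]) s0 q2 => s s0 ->.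
move: (s^-1 ^+ (2 * j)) => T.
by field; rewrite s0 gt_eqF.
Qed.

(** At eps = 0 the recursion turns the two lowest coefficients (p0, p1) into
(0, 2 p1 - 2 m p0), starting from (-1, 1), so these signs persist. *)
Lemma numerator_coef j :
  let p := specialize (0 : R) (numerator j) in p`_0 <= 0 /\ 0 < p`_1.
Proof.
elim: j => [|j [p0 p1]] /=.
  rewrite rmorphB /= map_polyX rmorph1 !coefB !coefX !coef1 /=; lra.
split.
  by rewrite specialize_numeratorS coefXM.
rewrite specialize_numeratorS coefXM /= -horner_coef0 !hornerE.
set p := specialize _ _ in p0 p1 *; set q := specialize _ _.
have q0 : q.[0] = 1 by rewrite specialize_radicand; ring.
have q1 : q^`().[0] = 2.
  have -> : q = 'X^2 + 2%:P * 'X + 1.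
    rewrite /q /radicand 2!rmorphD /= map_polyXn rmorphM /= map_polyC map_polyX.
    by rewrite rmorph1 /= /horner_eval !hornerE ?mulr0 ?subr0.
  rewrite !(derivD, derivM, derivXn, derivC, derivX) !hornerE /=.
  by ring.
have pE : p^`().[0] = p`_1 by rewrite horner_coef0 coef_deriv mulr1n.
rewrite hornerMn hornerM q0 q1 pE horner_coef0 -mulr_natr.
have : 0 <= (2 * j + 1)%:R :> R by [].
by move: (_%:R) => m; nra.
Qed.

Lemma numerator_nonroot j :
  exists2 c : R, 0 < c & (specialize (0 : R) (numerator j)).[c ^+ 2] != 0.
Proof.
have [_ p1] := numerator_coef j; set p := specialize _ _ in p1 *.
have pn0 : p != 0 by apply: contraTneq p1 => ->; rewrite coef0 ltxx.
(* More candidates than a nonzero polynomial has roots. *)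
pose rs := [seq ((i.+1)%:R ^+ 2 : R) | i <- iota 0 (size p)].
have rsu : uniq rs.
  rewrite map_inj_uniq ?iota_uniq // => a b /eqP.
  by rewrite eqrXn2 // eqr_nat eqSS => /eqP.
have : ~~ all (root p) rs.
  apply/negP => /(max_poly_roots pn0)/(_ rsu).
  by rewrite size_map size_iota ltnn.
by case/allPn => _ /mapP[i _ ->] ri; exists i.+1%:R.
Qed.

Lemma iterate_cvg j w : 0 < w ->
  iterate j e w @[e --> (0 : R)] --> iterate j 0 w.
Proof.
move=> w0; rewrite /iterate; under eq_fun do rewrite !specialize_horner.
rewrite !specialize_horner; apply: cvgM; first exact: continuous_horner.
have rad0 : 0 < radicand.[w%:P].[0 : R].
  by rewrite -specialize_horner; apply: radicand_gt0.
have Sc : (Num.sqrt radicand.[w%:P].[e])^-1 @[e --> (0 : R)] -->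
    (Num.sqrt radicand.[w%:P].[0])^-1.
  apply: cvgV; first by rewrite gt_eqF // sqrtr_gt0.
  apply: (@cvg_comp _ _ _ (horner radicand.[w%:P]) Num.sqrt).
    exact: continuous_horner.
  exact: sqrt_continuous.
apply: (@cvg_comp _ _ _ _ (fun x => x ^+ (2 * j + 1)) _ _ _ Sc).
exact: exprn_continuous.
Qed.

End Numerators.

(** * Iterated derivatives of the distance along X_0 *)

Section Along.
Context {R : realType} {mu nu : nat} (J : {linear 'cV[R]_nu -> 'M[R]_mu}).
Context (k0 : 'I_nu).
Local Notation V := (ambient R mu nu).
Local Notation slice := (@slice R mu nu k0).

Lemma slice_X0 z a h :
  slice z a + h *: X0 J (slice z a) = slice z (a + h * a).
Proof. by rewrite /slice; congr (_, _, _); rewrite /= scaler0 addr0. Qed.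

(** The ray p + s X_0(p) from a point of the half-plane stays in the half-plane,
so the derivative along X_0 is a d/da of the restriction to the vertical
line. *)
Lemma is_derive_X0 (f : V -> R^o) (F : R -> R) (z a d : R) :
  (forall b, 0 < b -> f (slice z b) = F b) -> 0 < a -> is_derive a 1 F d ->
  is_derive (slice z a) (X0 J (slice z a)) f (a * d).
Proof.
move=> fF a0 Fd; pose G (h : R) := a + h * a.
have Gd : is_derive (0 : R) 1 G a.
  have -> : G = cst a + (@id R) * cst a by [].
  by apply: is_derive_eq; rewrite /GRing.scale /=; ring.
have G0 : G 0 = a by rewrite /G mul0r addr0.
have FG : is_derive (0 : R) 1 (F \o G) (d * a).
  by apply: is_derive1_comp; rewrite G0.
have [/cvg_ex[l FGl] FGE] := FG.
have {}FGl : (fun h : R => h^-1 *: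
    ((F \o G \o shift 0) (h *: (1 : R)) - (F \o G) 0)) @ 0^' --> a * d.
  by rewrite mulrC -FGE; apply/cvg_ex; exists l.
have fl : (fun h : R => h^-1 *: ((f \o shift (slice z a))
    (h *: X0 J (slice z a)) - f (slice z a))) @ 0^' --> a * d.
  apply: cvg_trans FGl; apply: near_eq_cvg.
  near=> h; rewrite /= [h *: X0 _ _ + _]addrC slice_X0 addr0 G0 !fF //.
    by rewrite [_ *: 1]mulr1.
  have -> : a + h * a = (1 + h) * a by ring.
  rewrite mulr_gt0 //.
  have : `|h| < 1 by near: h; exact: dnbhs0_lt.
  by rewrite ltr_norml => /andP[]; lra.
apply: DeriveDef; first by apply/cvg_ex; exists (a * d).
exact: cvg_lim fl.
Unshelve. all: by end_near. Qed.

End Along.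

Section Distance.
Context {R : realType}.

Definition slice_dist (z a : R) : R :=
  ln ((1 + z ^+ 2 + a ^+ 2 +
       Num.sqrt ((1 + z ^+ 2 + a ^+ 2) ^+ 2 - 4 * a ^+ 2)) / (2 * a)).

(** Here X_0 r = (a^2 - b) / T, which is [iterate 0] in the variables w and
eps. *)
Lemma is_derive_slice_dist (z a : R) : 0 < z -> 0 < a ->
  is_derive a 1 (slice_dist z)
    (iterate 0 (1 + z ^+ 2)^-1 (a ^+ 2 / (1 + z ^+ 2)) / a).
Proof.
move=> z0 a0; set b := 1 + z ^+ 2.
have b1 : 1 < b by rewrite ltrDl exprn_gt0.
have b0 : 0 < b by lra.
pose D (y : R) := (b + y ^+ 2) ^+ 2 - 4 * y ^+ 2.
have D0 : 0 < D a.
  have -> : D a = (a ^+ 2 - b) ^+ 2 + 4 * (b - 1) * a ^+ 2 by rewrite /D; ring.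
  rewrite ltr_wpDl ?sqr_ge0 // mulr_gt0 ?exprn_gt0 //.
  by rewrite mulr_gt0 // subr_gt0.
have bd : is_derive a 1 (fun y : R => b + y ^+ 2) (2 * a).
  have -> : (fun y : R => b + y ^+ 2) = cst b + (@id R) ^+ 2 by [].
  by apply: is_derive_eq; rewrite /GRing.scale /=; ring.
have Dd : is_derive a 1 D (4 * a * (b + a ^+ 2) - 8 * a).
  have -> : D = (fun y : R => b + y ^+ 2) ^+ 2 - cst 4 * (@id R) ^+ 2 by [].
  by apply: is_derive_eq; rewrite /GRing.scale /=; ring.
have Td : is_derive a 1 (@Num.sqrt R \o D)
    ((2 * Num.sqrt (D a))^-1 * (4 * a * (b + a ^+ 2) - 8 * a)).
  exact: (is_derive1_comp (is_derive1_sqrt D0) Dd).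
pose N := (fun y : R => b + y ^+ 2) + (@Num.sqrt R \o D).
have T0 : 0 < Num.sqrt (D a) by rewrite sqrtr_gt0.
have N0 : 0 < N a by rewrite /N addr_gt0 // ltr_wpDr ?sqr_ge0.
have Nd : is_derive a 1 N _ := is_deriveD bd Td.
have lNd : is_derive a 1 (@ln R \o N) _ :=
  is_derive1_comp (is_derive1_ln N0) Nd.
have a20 : 0 < 2 * a by rewrite mulr_gt0.
have twod : is_derive a 1 (fun y : R => 2 * y) 2.
  have -> : (fun y : R => 2 * y) = cst 2 * (@id R) by [].
  by apply: is_derive_eq; rewrite /GRing.scale /=; ring.
have l2d : is_derive a 1 (@ln R \o (fun y : R => 2 * y)) _ :=
  @is_derive1_comp R (@ln R) (fun y : R => 2 * y) a _ _
    (is_derive1_ln a20) twod.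
apply: (@near_eq_is_derive _ _ _
  ((@ln R \o N) - (@ln R \o (fun y : R => 2 * y)))).
  near=> y.
  have y0 : 0 < y by near: y; exact: lt_nbhsr.
  rewrite /slice_dist ln_div ?posrE ?mulr_gt0 //.
  by rewrite ltr_wpDr ?sqrtr_ge0 // ltr_wpDr ?sqr_ge0.
apply: is_derive_eq (is_deriveB lNd l2d) _.
have qE : (specialize b^-1 radicand).[a ^+ 2 / b] = D a / b ^+ 2.
  by rewrite specialize_radicand /D; field; rewrite gt_eqF.
(* [iterate 0] equals (a ^ 2 / b - 1) / (T / b). *)
rewrite /iterate qE sqrtrM ?(ltW D0) // sqrtrV ?sqr_ge0 // sqrtr_sqr.
rewrite gtr0_norm //.
have -> : (specialize b^-1 (numerator 0)).[a ^+ 2 / b] =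
    a ^+ 2 / b - 1.
  by rewrite /= rmorphB /= map_polyX rmorph1 !hornerE.
have NE : N a = b + a ^+ 2 + Num.sqrt (D a) by [].
have DE : Num.sqrt (D a) ^+ 2 = (b + a ^+ 2) ^+ 2 - 4 * a ^+ 2.
  by rewrite sqr_sqrtr // ltW.
move: N0; rewrite NE; move: (Num.sqrt (D a)) T0 DE => T T0 T2 N0.
(* With T ^ 2 = (b + a ^ 2) ^ 2 - 4 a ^ 2, the numerator contains the factor
   b + a ^ 2 + T, which cancels. *)
have key : 2 * a ^+ 2 * (T + b + a ^+ 2 - 2) - T * (b + a ^+ 2) - T ^+ 2 =
    (a ^+ 2 - b) * (b + a ^+ 2 + T) by rewrite T2; ring.
transitivity ((2 * a ^+ 2 * (T + b + a ^+ 2 - 2) - T * (b + a ^+ 2) - T ^+ 2) /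
  (a * T * (b + a ^+ 2 + T))).
  by rewrite /GRing.scale /=; field; rewrite !gt_eqF.
by rewrite key; field; rewrite !gt_eqF.
Unshelve. all: by end_near. Qed.

(** This crude bound is what makes r tend to infinity along the curve. *)
Lemma slice_dist_ge (z a : R) : 0 < a -> ln (a / 2) <= slice_dist z a.
Proof.
move=> a0; have z2 := sqr_ge0 z; have a2 : 0 < a ^+ 2 by rewrite exprn_gt0.
set T := Num.sqrt ((1 + z ^+ 2 + a ^+ 2) ^+ 2 - 4 * a ^+ 2).
have T0 : 0 <= T by rewrite sqrtr_ge0.
rewrite /slice_dist -/T ler_ln ?posrE ?divr_gt0 ?mulr_gt0 //; last by lra.
rewrite ler_pdivlMr ?mulr_gt0 //.
have -> : a / 2 * (2 * a) = a ^+ 2 by field.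
by lra.
Qed.

End Distance.

Section Iterates.
Context {R : realType} {mu nu : nat} (J : {linear 'cV[R]_nu -> 'M[R]_mu}).
Context (k0 : 'I_nu).
Context (M_skew : (J (ebase k0))^T = - J (ebase k0)).
Context (M_orth : (J (ebase k0))^T *m J (ebase k0) = 1%:M).
Local Notation V := (ambient R mu nu).
Local Notation slice := (@slice R mu nu k0).

(** The induction carries the formula on the whole half-line a > 0, because the
next derivative along X_0 depends on neighbouring values of a. *)
Lemma X0_iter_dist_one j z a : 0 < z -> 0 < a ->
  X0_iter J j.+1 (dist_one J) (slice z a) =
    iterate j (1 + z ^+ 2)^-1 (a ^+ 2 / (1 + z ^+ 2)) /\
  derivable (X0_iter J j (dist_one J)) (slice z a) (X0 J (slice z a)).
Proof.
move=> z0; have b0 : 0 < 1 + z ^+ 2 by rewrite ltr_wpDr ?sqr_ge0.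
elim: j a => [|j IH] a a0.
  have H : is_derive (slice z a) (X0 J (slice z a)) (dist_one J : V -> R^o) _ :=
    is_derive_X0 J k0 _ _ _ _ _
    (fun b b0 => dist_one_slice J k0 z b M_skew M_orth z0 b0) a0
    (is_derive_slice_dist z a z0 a0).
  split; last by have [] := H.
  rewrite /X0_iter /= /vf_act; have [_ ->] := H.
  by field; rewrite gt_eqF.
set b := 1 + z ^+ 2 in IH b0 *.
pose w (y : R) := y ^+ 2 / b.
have wd : is_derive a 1 w (2 * a / b).
  have -> : w = (@id R) ^+ 2 * cst b^-1 by [].
  by apply: is_derive_eq; rewrite /GRing.scale /=; ring.
have w0 : 0 < w a by rewrite divr_gt0 // exprn_gt0.
have e1 : b^-1 < 1 by rewrite invf_lt1 // ltrDl exprn_gt0.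
have Fd : is_derive a 1 (iterate j b^-1 \o w) _ :=
  @is_derive1_comp R (iterate j b^-1) w a _ _
    (is_derive_iterate j _ _ e1 w0) wd.
have H : is_derive (slice z a) (X0 J (slice z a))
    (X0_iter J j.+1 (dist_one J)) _ :=
  is_derive_X0 J k0 _ _ _ _ _ (fun y y0 => (IH y y0).1) a0 Fd.
split; last by have [] := H.
rewrite /X0_iter iterS -/(X0_iter J j.+1 _) /vf_act; have [_ ->] := H.
rewrite -/(w a); set v := iterate _ _ _.
by rewrite /w; field; rewrite !gt_eqF.
Qed.

Lemma X0_iter_exists_dist_one j z a : 0 < z -> 0 < a ->
  X0_iter_exists J j (dist_one J) (slice z a).
Proof.
move=> z0 a0 i _; near=> s; rewrite slice_X0.
have [|_] := X0_iter_dist_one i z (a + s * a) z0 _; last by [].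
have -> : a + s * a = (1 + s) * a by ring.
rewrite mulr_gt0 //.
have : `|s| < 1 by near: s; exact: (@nbhs0_lt R R 1 ltr01).
by rewrite ltr_norml => /andP[]; lra.
Unshelve. all: by end_near. Qed.

End Iterates.

(** * The curve *)

Theorem proposition3p6 (R : realType) (mu nu : nat)
    (J : {linear 'cV[R]_nu -> 'M[R]_mu})
    (nu_ge1 : (1 <= nu)%N)
    (J_skew : forall z : 'cV[R]_nu, (J z)^T = - J z)
    (J_orth : forall z : 'cV[R]_nu,
      Num.sqrt (dotp z z) = 1 -> (J z)^T *m J z = 1%:M)
    (k : nat) (k_ge1 : (1 <= k)%N) :
  exists (gamma : R -> ambient R mu nu) (b : R),
    [/\ smooth_curve gamma /\ (forall a : R, 0 < a -> in_S (gamma a)),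
        b != 0,
        dist_one J (gamma a) @[a --> +oo] --> +oo,
        \forall a \near +oo, X0_iter_exists J k (dist_one J) (gamma a) &
        X0_iter J k (dist_one J) (gamma a) @[a --> +oo] --> b].
Proof.
pose k0 : 'I_nu := Ordinal nu_ge1.
have M_orth : (J (ebase k0))^T *m J (ebase k0) = 1%:M.
  by apply: J_orth; rewrite dotp_ebase mxE !eqxx sqrtr1.
have M_skew := J_skew (ebase k0).
case: k k_ge1 => [//|j _].
have [c c0 pc] := @numerator_nonroot R j.
pose sh (a : R) := (expR a - expR (- a)) / 2.
pose ch (a : R) := (expR a + expR (- a)) / 2.
have chsh a : 1 + sh a ^+ 2 = ch a ^+ 2.
  transitivity (expR a * expR (- a) + sh a ^+ 2).
    by rewrite -expRD subrr expR0.
  by rewrite /sh /ch; field.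
have ch0 a : 0 < ch a by rewrite divr_gt0 // addr_gt0 ?expR_gt0.
have sh0 a : 0 < a -> 0 < sh a.
  move=> a0; rewrite divr_gt0 // subr_gt0 ltr_expR; lra.
(* The curve (sinh t, c cosh t), as a combination of e ^ t and e ^ - t. *)
pose v : ambient R mu nu := slice k0 2^-1 (c / 2).
pose w : ambient R mu nu := slice k0 (- 2^-1) (c / 2).
pose gamma a := expR a *: v + expR (- a) *: w.
have gammaE a : gamma a = slice k0 (sh a) (c * ch a).
  rewrite /gamma /v /w /slice; congr (_, _, _); rewrite /= ?scaler0 ?addr0 //.
    by rewrite !scalerA -scalerDl; congr (_ *: _); rewrite /sh; ring.
  by rewrite /GRing.scale /= /ch; ring.
exists gamma, (iterate j 0 (c ^+ 2)); split.
- split=> [i a _|a _].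
    by have [-> d] := derive1n_exp_comb v w i; exact: d.
  by rewrite gammaE /in_S /= mulr_gt0.
- rewrite mulf_neq0 // expf_neq0 // invr_neq0 // gt_eqF // sqrtr_gt0.
  by rewrite radicand_gt0 // exprn_gt0.
- apply/cvgryPge => A; near=> a.
  have a0 : 0 < a by near: a; exact: nbhs_pinfty_gt.
  have sa0 := sh0 a a0; have ca0 : 0 < c * ch a by rewrite mulr_gt0.
  have c4 : 0 < c / 4 by rewrite divr_gt0.
  rewrite gammaE dist_one_slice //; apply: le_trans (slice_dist_ge _ _ ca0).
  have : ln (c / 4 * expR a) <= ln (c * ch a / 2).
    rewrite ler_ln ?posrE; first by rewrite /ch; have := expR_gt0 (- a); nra.
      by rewrite mulr_gt0 ?expR_gt0.
    by rewrite divr_gt0.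
  rewrite lnM ?posrE ?expR_gt0 // expRK.
  have : A - ln (c / 4) <= a by near: a; apply: nbhs_pinfty_ge; exact: num_real.
  lra.
- near=> a; rewrite gammaE; apply: X0_iter_exists_dist_one => //.
    by apply: sh0; near: a; exact: nbhs_pinfty_gt.
  by rewrite mulr_gt0.
- have e_cvg : (1 + sh a ^+ 2)^-1 @[a --> +oo] --> (0 : R).
    have ch_ge a : expR a / 2 <= ch a.
      by have := expR_gt0 (- a); rewrite /ch; lra.
    have small : expR (- a) * 2 @[a --> +oo] --> (0 : R).
      rewrite -(mul0r 2); apply: cvgM; last exact: cvg_cst.
      exact: cvgr_expR.
    apply: (@squeeze_cvgr _ _ _ _ (fun=> 0) (fun a => expR (- a) * 2));
      [|exact: cvg_cst|exact: small].
    near=> a; rewrite chsh; apply/andP; split.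
      by rewrite invr_ge0 sqr_ge0.
    have -> : expR (- a) * 2 = (expR a / 2)^-1 by rewrite expRN invf_div mulrC.
    have e0 : 0 < expR a / 2 by rewrite divr_gt0 ?expR_gt0.
    have ch20 : 0 < ch a ^+ 2 by rewrite exprn_gt0.
    rewrite lef_pV2 ?posrE //.
    apply: le_trans (ch_ge a) _; rewrite expr2 ler_peMl ?(ltW (ch0 a)) //.
    by rewrite -(@expr_ge1 _ 2) ?(ltW (ch0 a)) // -chsh lerDl sqr_ge0.
  apply: cvg_trans (cvg_comp _ _ e_cvg (iterate_cvg j (c ^+ 2) _)); last first.
    by rewrite exprn_gt0.
  apply: near_eq_cvg; near=> a.
  have a0 : 0 < a by near: a; exact: nbhs_pinfty_gt.
  rewrite gammaE (X0_iter_dist_one J k0 M_skew M_orth j (sh a) (c * ch a)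
    (sh0 a a0) (mulr_gt0 c0 (ch0 a))).1 /=.
  (* The variable w is constant along the curve. *)
  have wE : (c * ch a) ^+ 2 / (1 + sh a ^+ 2) = c ^+ 2.
    by rewrite chsh; field; rewrite gt_eqF.
  by rewrite wE.
Unshelve. all: by end_near. Qed.
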